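(* Let $X$ be a finite non-degenerate cycle set. If $|X|=2$, then $X$ is simple. If $|X|>2$, then the following conditions are equivalent: 1) $X$ is a simple cycle set; 2) either $X$ is, up to isomorphism, the unique indecomposable cycle set of size $p$ for some prime number $p$, or $X$ is an irretractable and indecomposable cycle set such that every non-trivial ideal of the left brace $\mathcal{G}(X)$ acts transitively on $X$; 3) either $X$ is, up to isomorphism, the unique indecomposable cycle set of size $p$ for some prime number $p$, or $X$ is an irretractable and indecomposable cycle set such that the left brace $\mathcal{G}(X)$ has a unique minimal ideal $I$, and $I$ acts transitively on $X$.
   Context: A cycle set is a non-empty set $X$ with a binary operation $\cdot$ such that each left multiplication $\sigma_x:X\to X$, $y\mapsto x\cdot y$, is bijective and $(x\cdot y)\cdot(x\cdot z)=(y\cdot x)\cdot(y\cdot z)$ for all $x,y,z\in X$. It is non-degenerate if $x\mapsto x\cdot x$ is bijective. All cycle sets are assumed to be finite and non-degenerate. A homomorphism of cycle sets is a map $f$ with $f(x\cdot y)=f(x)\cdot f(y)$; an epimorphism is a surjective homomorphism, an isomorphism is a bijective homomorphism. A cycle set $X$ is simple if $|X|>1$ and for every epimorphism $f$ from $X$ to a cycle set $Y$, either $|Y|=1$ or $f$ is an isomorphism. $\mathcal{G}(X)$ denotes the subgroup of $\mathrm{Sym}(X)$ generated by $\{\sigma_x : x\in X\}$. $X$ is indecomposable if $\mathcal{G}(X)$ acts transitively on $X$. $X$ is irretractable if $\sigma_x=\sigma_y$ implies $x=y$ (equivalently, $X$ equals its retraction, the quotient of $X$ by the congruence $x\sim y\Leftrightarrow\sigma_x=\sigma_y$).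 By a known theorem of Etingof, Schedler and Soloviev, for each prime $p$ there is, up to isomorphism, exactly one indecomposable cycle set of size $p$, namely the one for which all $\sigma_x$ are equal to the same $p$-cycle. A left brace is a set $A$ with two operations $+$ and $\circ$ such that $(A,+)$ is an abelian group, $(A,\circ)$ is a group, and $a\circ(b+c)+a=a\circ b+a\circ c$ for all $a,b,c\in A$. The two identity elements coincide and are denoted $0$. Put $\lambda_a(b):=-a+a\circ b$. An ideal of $A$ is a normal subgroup $I$ of $(A,\circ)$ such that $\lambda_a(I)\subseteq I$ for every $a\in A$. An ideal is non-trivial if it is different from $\{0\}$ (so the whole brace, if non-zero, counts as non-trivial). A minimal ideal is a non-trivial ideal that is minimal with respect to inclusion among the non-trivial ideals. The left brace $\mathcal{G}(X)$ (the associated left brace) is the group $\mathcal{G}(X)$ with $\circ$ the composition of permutations and with the standard addition, i.e. the unique operation $+$ making $(\mathcal{G}(X),+,\circ)$ a left brace such that $g+\sigma_y^{-1}=g\circ\sigma_{g^{-1}(y)}^{-1}$ for all $g\in\mathcal{G}(X)$, $y\in X$ (equivalently $\lambda_g(\sigma_x^{-1})=\sigma_{g(x)}^{-1}$ for all $g\in\mathcal{G}(X)$, $x\in X$). Its zero element is $\mathrm{id}_X$. Ideals of $\mathcal{G}(X)$ are subgroups of $\mathrm{Sym}(X)$ and act on $X$ as permutation groups. *)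

(* Defs.v *)
From HB Require Import structures.
From mathcomp Require Import all_boot all_order all_algebra all_fingroup.

Set Implicit Arguments.
Unset Strict Implicit.
Unset Printing Implicit Defensive.

Import GroupScope GRing.Theory.

(** * Finite non-degenerate cycle sets *)

HB.mixin Record isCycleSet X of Finite X := {
  cdot : X -> X -> X;
  cdot_bij : forall x, bijective (cdot x);
  cdot_cycle : forall x y z,
    cdot (cdot x y) (cdot x z) = cdot (cdot y x) (cdot y z);
  cdot_nondegenerate : bijective (fun x => cdot x x);
  cycle_set_nonempty : 0 < #|{: X}|
}.

#[short(type="cycleSetType")]
HB.structure Definition CycleSet := { X of Finite X & isCycleSet X }.

Notation "x · y" := (cdot x y) (at level 40, left associativity).

Definition sigma (X : cycleSetType) (x : X) : {perm X} :=
  perm (bij_inj (cdot_bij x)).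

Definition cycle_hom (X Y : cycleSetType) (f : X -> Y) : Prop :=
  {morph f : x y / x · y}.

Definition cycle_epi (X Y : cycleSetType) (f : X -> Y) : Prop :=
  cycle_hom f /\ forall y, exists x, f x = y.

Definition cycle_iso (X Y : cycleSetType) (f : X -> Y) : Prop :=
  cycle_hom f /\ bijective f.

Definition cycle_isomorphic (X Y : cycleSetType) : Prop :=
  exists f : X -> Y, cycle_iso f.

Definition simple_cycle_set (X : cycleSetType) : Prop :=
  1 < #|{: X}| /\
  forall (Y : cycleSetType) (f : X -> Y),
    cycle_epi f -> #|{: Y}| = 1%N \/ cycle_iso f.

(* Composition of permutations in the order of MathComp and in the usual order
   generate the same subgroup of Sym(X). *)
Definition perm_group (X : cycleSetType) : {group {perm X}} :=
  <<[set sigma x | x : X]>>%G.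

Definition indecomposable (X : cycleSetType) : Prop :=
  [transitive perm_group X, on [set: X] | 'P].

Definition irretractable (X : cycleSetType) : Prop :=
  forall x y : X, sigma x = sigma y -> x = y.

(** * The indecomposable cycle set of prime size *)

(* All [sigma x] are the p-cycle [y |-> y + 1] of Z/p; meaningful for p > 1
   only, since ['Z_0] and ['Z_1] are Z/2. *)
Definition cyclic_cycle_set (p : nat) : Type := 'Z_p.

Section CyclicCycleSet.
Variable p : nat.

HB.instance Definition _ := Finite.copy (cyclic_cycle_set p) 'Z_p.

Definition cyclic_dot (x y : cyclic_cycle_set p) : cyclic_cycle_set p :=
  ((y : 'Z_p) + 1)%R.

Lemma cyclic_dot_bij x : bijective (cyclic_dot x).
Proof.
by exists (fun y => (y : 'Z_p) - 1)%R => y; rewrite /cyclic_dot (addrK, subrK).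
Qed.

Lemma cyclic_dot_cycle x y z :
  cyclic_dot (cyclic_dot x y) (cyclic_dot x z) =
  cyclic_dot (cyclic_dot y x) (cyclic_dot y z).
Proof. by []. Qed.

Lemma cyclic_dot_nondegenerate : bijective (fun x => cyclic_dot x x).
Proof. exact: (cyclic_dot_bij 0%R). Qed.

Lemma cyclic_nonempty : 0 < #|{: cyclic_cycle_set p}|.
Proof. by rewrite card_ord. Qed.

HB.instance Definition _ := isCycleSet.Build (cyclic_cycle_set p)
  cyclic_dot_bij cyclic_dot_cycle cyclic_dot_nondegenerate cyclic_nonempty.

End CyclicCycleSet.

Lemma cyclic_cycle_set_card p : prime p -> #|{: cyclic_cycle_set p}| = p.
Proof. by move=> /prime_gt1 p1; rewrite card_ord Zp_cast. Qed.

Lemma cyclic_cycle_set_indecomposable p : indecomposable (cyclic_cycle_set p).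
Proof.
apply/imsetP; exists (0%R : 'Z_p) => //; apply/esym/setP => y.
rewrite inE; apply/orbitP.
pose s := sigma (0%R : cyclic_cycle_set p).
exists (s ^+ (y : 'Z_p)).
  by rewrite groupX // mem_gen // imset_f.
rewrite /= apermE.
suff E n : (s ^+ n) (0%R : 'Z_p) = (n%:R)%R :> 'Z_p by rewrite E natr_Zp.
elim: n => [|n IH]; first by rewrite expg0 perm1.
by rewrite expgSr permM IH /s permE /= -natr1.
Qed.

(** * Left braces *)

(* The group [(A, o)] is the multiplicative one (group_scope), the group
   [(A, +)] the additive one (ring_scope). *)
HB.mixin Record isLeftBrace A of monoid.Group A & GRing.Zmodule A := {
  brace_distr : forall a b c : A,
    ((a * (b + c)%R)%g + a = (a * b)%g + (a * c)%g)%R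
}.

#[short(type="leftBraceType")]
HB.structure Definition LeftBrace :=
  { A of monoid.Group A & GRing.Zmodule A & isLeftBrace A }.

#[short(type="finLeftBraceType")]
HB.structure Definition FinLeftBrace := { A of LeftBrace A & Finite A }.

Definition brace_lambda (A : leftBraceType) (a b : A) : A := (- a + (a * b)%g)%R.

Lemma brace_zero_one (A : leftBraceType) : (0%R : A) = 1%g.
Proof.
have := brace_distr (1%g : A) 0%R 0%R.
by rewrite !mul1g !add0r.
Qed.

Definition brace_ideal (A : finLeftBraceType) (I : {group A}) : Prop :=
  I <| [set: A] /\ forall a b : A, b \in I -> brace_lambda a b \in I.

Definition nontrivial_ideal (A : finLeftBraceType) (I : {group A}) : Prop :=
  brace_ideal I /\ I <> [set 0%R] :> {set A}.

Definition minimal_ideal (A : finLeftBraceType) (I : {group A}) : Prop :=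
  nontrivial_ideal I /\
  forall J : {group A}, nontrivial_ideal J -> J \subset I -> J = I.

(** * The left brace associated with a cycle set *)

Definition perm_brace (X : cycleSetType) : Type := subg_of (perm_group X).

Section PermBrace.
Variable X : cycleSetType.
Implicit Types (x y z : X).

HB.instance Definition _ := Finite.copy (perm_brace X) (subg_of (perm_group X)).

Definition perm_of_brace (g : perm_brace X) : {perm X} := sgval g.

(* Function composition: [(g o h) x = g (h x)], whereas MathComp's product of
   permutations is [(g * h) x = h (g x)]. *)
Definition brace_comp (g h : perm_brace X) : perm_brace X := subg_mul h g.
Definition brace_id : perm_brace X := subg_one (perm_group X).
Definition brace_compV (g : perm_brace X) : perm_brace X := subg_inv g.

Lemma brace_compA : associative brace_comp.
Proof. by move=> a b c; apply: val_inj; rewrite /= mulgA. Qed.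

Lemma brace_comp1g : left_id brace_id brace_comp.
Proof. by move=> a; apply: val_inj; rewrite /= mulg1. Qed.

Lemma brace_compVg : left_inverse brace_id brace_compV brace_comp.
Proof. by move=> a; apply: val_inj; rewrite /= mulgV. Qed.

HB.instance Definition _ := Finite_isGroup.Build (perm_brace X)
  brace_compA brace_comp1g brace_compVg.

Lemma sigma_in_group x : sigma x \in perm_group X.
Proof. by rewrite mem_gen // imset_f. Qed.

Definition brace_sigma x : perm_brace X := Subg (sigma_in_group x).

Lemma perm_of_brace_inj : injective perm_of_brace.
Proof. exact: val_inj. Qed.

Lemma perm_of_braceM (g h : perm_brace X) x :
  perm_of_brace (g * h) x = perm_of_brace g (perm_of_brace h x).
Proof. exact: permM. Qed.

Lemma perm_of_braceV (g : perm_brace X) :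
  perm_of_brace g^-1 = (perm_of_brace g)^-1.
Proof. by []. Qed.

Lemma perm_of_brace_sigma x y : perm_of_brace (brace_sigma x) y = x · y.
Proof. exact: permE. Qed.

(* The maps [g |-> g + sigma_y^-1] prescribed by the definition of the standard
   addition are commuting permutations of the group; the abelian group they
   generate acts regularly, and [g + h] is the image of [g] under its unique
   element sending the identity to [h]. *)
Definition translation y (g : perm_brace X) : perm_brace X :=
  g * (brace_sigma ((perm_of_brace g)^-1 y))^-1.

Lemma translation_inj y : injective (translation y).
Proof.
have E (g : perm_brace X) : let a := (perm_of_brace g)^-1 y in
    (perm_of_brace (translation y g))^-1 y = a · a.
  move=> a; rewrite -perm_of_braceV /translation invMg invgK perm_of_braceM.
  by rewrite perm_of_brace_sigma perm_of_braceV.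
move=> g h gh; have := E g; rewrite gh E.
move/(bij_inj cdot_nondegenerate) => ab.
by move: gh; rewrite /translation ab => /mulIg.
Qed.

Definition translation_perm y : {perm perm_brace X} := perm (@translation_inj y).

Definition translation_group : {group {perm perm_brace X}} :=
  <<[set translation_perm y | y : X]>>%G.

Lemma translationC y z g :
  translation y (translation z g) = translation z (translation y g).
Proof.
have E a b : translation a (translation b g) =
    g * (brace_sigma (((perm_of_brace g)^-1 b) · ((perm_of_brace g)^-1 a)) *
         brace_sigma ((perm_of_brace g)^-1 b))^-1.
  rewrite {1}/translation -perm_of_braceV {2}/translation invMg invgK.
  by rewrite perm_of_braceM perm_of_brace_sigma perm_of_braceV invMg mulgA.
rewrite !E; congr (_ * _^-1); apply: perm_of_brace_inj; apply/permP => t.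
by rewrite !perm_of_braceM !perm_of_brace_sigma cdot_cycle.
Qed.

Lemma translation_group_abelian : abelian translation_group.
Proof.
rewrite abelian_gen; apply/centsP => _ /imsetP[y _ ->] _ /imsetP[z _ ->].
by apply/permP => g; rewrite !permM !permE translationC.
Qed.

Lemma brace_gen_ind (P : perm_brace X -> Prop) :
  P 1 -> (forall g x, P g -> P (g * (brace_sigma x)^-1)) -> forall g, P g.
Proof.
move=> P1 PM g.
have PK n h x : P h -> P (h * (brace_sigma x)^-1 ^+ n).
  by move=> Ph; elim: n => [|n IH]; rewrite ?mulg1 // expgSr mulgA; apply: PM.
have PM' h x : P h -> P (h * brace_sigma x).
  move=> Ph; have := PK #[brace_sigma x].-1 h x Ph.
  by rewrite expgVn -invg_expg // invgK.
case: g => g gG.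
have [n [c cin gE]] := gen_prodgP gG.
suff: forall h : perm_brace X, perm_of_brace h = \prod_(i < n) c i -> P h.
  by move=> H; apply: H.
elim: n c cin {g gG gE} => [|n IH] c cin h /=.
  rewrite big_ord0 => h1; suff -> : h = 1 by [].
  exact: val_inj.
rewrite big_ord_recl => hE.
have /imsetP[x _ cx] := cin ord0.
have -> : h = (h * (brace_sigma x)^-1) * brace_sigma x by rewrite mulgKV.
apply: PM'; apply: (IH (fun i => c (lift ord0 i))) => //.
by rewrite /= [sgval h]hE cx mulKg.
Qed.

Lemma translation_group_transitive (g : perm_brace X) :
  exists2 t, t \in translation_group & t 1 = g.
Proof.
elim/brace_gen_ind: g => [|g x [t tT tg]]; first by exists 1; rewrite ?perm1.
exists (t * translation_perm (perm_of_brace g x)).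
  by rewrite groupM // mem_gen // imset_f.
by rewrite permM tg permE /translation permK.
Qed.

Lemma translation_group_free t (g : perm_brace X) u :
  t \in translation_group -> u \in translation_group -> t g = u g -> t = u.
Proof.
move=> tT uT E; apply/permP => h.
have [a aT ag] := translation_group_transitive g.
have [b bT bh] := translation_group_transitive h.
have -> : h = (a^-1 * b) g by rewrite permM -ag permK bh.
have cT := groupM (groupVr aT) bT.
have /centsP C := translation_group_abelian.
by rewrite -!permM -(C _ tT _ cT) -(C _ uT _ cT) !permM E.
Qed.

Definition translation_to (h : perm_brace X) : {perm perm_brace X} :=
  odflt 1 [pick t in translation_group | t 1 == h].

Lemma translation_toP h :
  translation_to h \in translation_group /\ translation_to h 1 = h.
Proof.
rewrite /translation_to; case: pickP => [t /andP[? /eqP ?] //|H].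
have [t tT th] := translation_group_transitive h.
by have := H t; rewrite tT th eqxx.
Qed.

Definition brace_add (g h : perm_brace X) : perm_brace X := translation_to h g.
Definition brace_opp (g : perm_brace X) : perm_brace X :=
  (translation_to g)^-1 1.

Lemma translation_to_unique t h :
  t \in translation_group -> t 1 = h -> t = translation_to h.
Proof.
have [? E] := translation_toP h => tT th.
by apply: (@translation_group_free _ 1) => //; rewrite E.
Qed.

Lemma brace_addC : commutative brace_add.
Proof.
move=> g h; rewrite /brace_add.
have [gT gE] := translation_toP g; have [hT hE] := translation_toP h.
suff : translation_to h (translation_to g 1) =
       translation_to g (translation_to h 1) by rewrite gE hE.
rewrite -!permM; congr (fun_of_perm _ _).
by have /centsP C := translation_group_abelian; apply: C.
Qed.

Lemma brace_addA : associative brace_add.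
Proof.
move=> a b c; rewrite /brace_add.
have [bT bE] := translation_toP b; have [cT cE] := translation_toP c.
rewrite -permM; congr (fun_of_perm _ _); apply/esym/translation_to_unique.
  exact: groupM.
by rewrite permM bE.
Qed.

Lemma brace_add0 : left_id 1 brace_add.
Proof. by move=> g; rewrite /brace_add; case: (translation_toP g). Qed.

Lemma brace_addN : left_inverse 1 brace_opp brace_add.
Proof. by move=> g; rewrite /brace_add /brace_opp permKV. Qed.

HB.instance Definition _ := GRing.isZmodule.Build (perm_brace X)
  brace_addA brace_addC brace_add0 brace_addN.

Lemma brace_add_translation y (g : perm_brace X) :
  (g + (brace_sigma y)^-1%g)%R = translation y g.
Proof.
have -> : (g + (brace_sigma y)^-1%g)%R = translation_to (brace_sigma y)^-1 g by [].
rewrite -(@translation_to_unique (translation_perm y)) ?permE //.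
  by rewrite mem_gen // imset_f.
by rewrite /translation invg1 perm1 mul1g.
Qed.

Lemma perm_brace_distr (a b c : perm_brace X) :
  ((a * (b + c)%R)%g + a = (a * b)%g + (a * c)%g)%R.
Proof.
elim/brace_gen_ind: c b => [|c x IH] b.
  by rewrite mulg1 (addr0 b : (b + 1%g)%R = b).
set y := perm_of_brace c x.
have cE : c * (brace_sigma x)^-1 = (c + (brace_sigma y)^-1%g)%R.
  by rewrite brace_add_translation /translation permK.
have aT (h : perm_brace X) : a * (h + (brace_sigma y)^-1%g)%R =
    ((a * h)%g + (brace_sigma (perm_of_brace a y))^-1%g)%R.
  rewrite !brace_add_translation /translation mulgA; congr (_ * (brace_sigma _)^-1).
  by rewrite -!perm_of_braceV invMg perm_of_braceM [in RHS]perm_of_braceV permK.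
rewrite cE addrA !aT addrA -IH -!addrA; congr (_ + _)%R; exact: addrC.
Qed.

HB.instance Definition _ := isLeftBrace.Build (perm_brace X) perm_brace_distr.

End PermBrace.

(* The structure just built is the associated left brace: its addition satisfies
   the defining identity of the standard addition, and is the only addition of
   a left brace on the group that does. *)
Lemma perm_brace_addE (X : cycleSetType) (g : perm_brace X) (y : X) :
  (g + (brace_sigma y)^-1%g)%R =
  g * (brace_sigma ((perm_of_brace g)^-1 y))^-1.
Proof. exact: brace_add_translation. Qed.

Lemma perm_brace_add_unique (X : cycleSetType)
    (add : perm_brace X -> perm_brace X -> perm_brace X) (zero : perm_brace X)
    (opp : perm_brace X -> perm_brace X) :
  associative add -> commutative add -> left_id zero add ->
  left_inverse zero opp add ->
  (forall a b c, add (a * add b c) a = add (a * b) (a * c)) ->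
  (forall g y, add g (brace_sigma y)^-1 =
               g * (brace_sigma ((perm_of_brace g)^-1 y))^-1) ->
  forall g h, add g h = (g + h)%R.
Proof.
move=> addA addC add0 addN distr addE g h.
have zero1 : zero = 1.
  by have := distr 1 zero zero; rewrite !mul1g !add0.
elim/brace_gen_ind: h g => [|h x IH] g.
  rewrite -{1}zero1 addC add0.
  by rewrite (addr0 g : (g + 1%g)%R = g).
set y := perm_of_brace h x.
have hE : h * (brace_sigma x)^-1 = (h + (brace_sigma y)^-1%g)%R.
  by rewrite perm_brace_addE permK.
rewrite {2}hE addrA -IH perm_brace_addE -addE -addA.
by congr add; rewrite addE permK.
Qed.

Definition acts_transitively (X : cycleSetType)
    (I : {group (perm_brace X)}) : Prop :=
  [transitive (@perm_of_brace X) @: I, on [set: X] | 'P].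

(* Main.v *)
Require Import Defs.
From HB Require Import structures.
From mathcomp Require Import all_boot all_order all_algebra all_fingroup.
From mathcomp Require Import cyclic.

Set Implicit Arguments.
Unset Strict Implicit.
Unset Printing Implicit Defensive.

Import GroupScope GRing.Theory.

(** Quotients of [X] and ideals of its brace correspond closely enough for
    simplicity to be read off the ideals.

    From ideals to quotients: if [g] lies in an ideal [I], then [lambda_g] acts
    trivially modulo [I], and since [lambda_g] sends the inverse of [sigma x] to
    that of [sigma (g x)], the permutations [sigma x] and [sigma (g x)] agree
    modulo [I] ([ideal_sigma_coset]). So the orbits of [I] form a congruence
    ([ideal_orbit_congruence]), and if [X] is simple, a non-trivial ideal has
    only one orbit. Applied to the whole brace, this gives indecomposability,
    as soon as the brace is non-trivial; this is where [2 < #|X|] is used. The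
    relation [sigma x = sigma y] is a congruence too, so a simple [X] is
    irretractable or has a single [sigma x = s]. In the second case [s] is a
    cycle of length [#|X|] whose powers have orbits that form congruences, so
    [#|X|] is prime and [X] is the cyclic cycle set
    ([simple_irretractable_or_cyclic]).

    From quotients to ideals: an epimorphism [f] from [X] induces a homomorphism
    of braces, whose kernel is the ideal of the permutations that preserve each
    fibre of [f] ([epi_kernel_ideal]). If the kernel is transitive, then [f] is
    constant. If it is trivial, then [f x = f y] forces [sigma x = sigma y],
    so [f] is injective when [X] is irretractable. The cyclic cycle set of prime
    size is simple because the fibres of an epimorphism from an indecomposable
    cycle set have equal sizes ([indecomposable_epi_dvd]).

    Minimal ideals: if all non-trivial ideals are transitive, two distinct
    minimal ideals [I] and [J] would meet trivially, but then [sigma x] and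
    [sigma y] agree modulo [I] and modulo [J], so are equal, for all [x] and [y]
    ([transitive_ideals_meet]). Conversely, every non-trivial ideal contains a
    minimal one, and inherits its transitivity. *)

(** * Ideals of left braces *)

Section Braces.
Variable A : finLeftBraceType.
Implicit Types (a b g : A) (I J : {group A}).

Lemma brace_mul_lambda a b : a * b = (a + brace_lambda a b)%R.
Proof. by rewrite /brace_lambda addrA subrr add0r. Qed.

Lemma brace_add_lambda a b : (a + b)%R = a * brace_lambda a^-1 b.
Proof.
have aN : a * (- a^-1%g)%R = (a + a)%R.
  have := brace_distr a a^-1 (- a^-1%g)%R.
  by rewrite subrr mulgV brace_zero_one mulg1 -brace_zero_one add0r.
apply: (addIr a); rewrite /brace_lambda brace_distr mulKVg aN.
by rewrite -!addrA [(b + a)%R]addrC.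
Qed.

Lemma brace_opp_lambda a : (- a)%R = brace_lambda a a^-1.
Proof. by rewrite /brace_lambda mulgV -brace_zero_one addr0. Qed.

(** Addition and opposite are products of [lambda]-images, so an ideal, although
    defined multiplicatively, is an additive subgroup; hence
    [lambda_g b = - g + g * b] lies in the coset of [g * b], which is that of
    [b] by normality. *)
Lemma ideal_lambda_coset I g b :
  brace_ideal I -> g \in I -> b^-1 * brace_lambda g b \in I.
Proof.
case=> /andP[_ nI] lamI gI.
have -> : b^-1 * brace_lambda g b =
    g ^ b * brace_lambda (g * b)^-1 (brace_lambda g g^-1).
  rewrite {1}/brace_lambda brace_opp_lambda addrC brace_add_lambda.
  by rewrite conjgE !mulgA.
rewrite groupM //; first by rewrite memJ_norm // (subsetP nI) ?inE.
by apply/lamI/lamI; rewrite groupV.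
Qed.

Lemma brace_idealT : brace_ideal [set: A]%G.
Proof. by split=> [|*]; rewrite ?normal_refl ?inE. Qed.

Lemma brace_idealI I J :
  brace_ideal I -> brace_ideal J -> brace_ideal (I :&: J)%G.
Proof.
move=> [nI lI] [nJ lJ]; split=> [|a b /setIP[bI bJ]]; first exact: normalI.
by rewrite inE lI ?lJ.
Qed.

Lemma minimal_ideal_exists I :
  nontrivial_ideal I -> exists2 J : {group A}, minimal_ideal J & J \subset I.
Proof.
have [n] := ubnP #|I|; elim: n I => // n IH I /ltnSE leIn ntI.
(* Among the finitely many subgroups a smaller ideal can be searched for, once
   ideals are described by a boolean predicate. *)
pose idb (J : {group A}) := [&& J <| [set: A],
  [forall a, forall b in J, brace_lambda a b \in J] & (J : {set A}) != [set 0%R]].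
have idbP J : reflect (nontrivial_ideal J) (idb J).
  apply: (iffP and3P) => [[nJ /forallP lJ /eqP J0]|[[nJ lJ] /eqP J0]].
    by split=> //; split=> // a b; have /forall_inP := lJ a; apply.
  by split=> //; apply/forallP => a; apply/forall_inP => b; apply: lJ.
case: (pickP [pred J : {group A} | idb J & J \proper I]) => [J|noJ].
  case/andP=> /idbP ntJ pJI; have lt := proper_card pJI.
  have [K mK sKJ] := IH J (leq_trans lt leIn) ntJ.
  by exists K => //; apply: subset_trans sKJ (proper_sub pJI).
exists I => //; split=> // J /idbP ntJ sJI; apply/val_inj/eqP => /=.
have := noJ J; rewrite /= ntJ /= properEneq sJI andbT.
by move/negbFE.
Qed.

End Braces.

(** * The associated brace and its action *)

Section Action.
Variable X : cycleSetType.
Implicit Types (x y z : X) (g h : perm_brace X) (I J : {group (perm_brace X)}).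

Lemma lambda_brace_sigma g x :
  brace_lambda g (brace_sigma x)^-1 = (brace_sigma (perm_of_brace g x))^-1.
Proof.
rewrite /brace_lambda -{1}[x](permK (perm_of_brace g)) -perm_brace_addE.
by rewrite addrA addNr add0r.
Qed.

(** As [lambda_g] sends the inverse of [sigma x] to that of [sigma (g x)],
    an ideal that moves [x] to [g x] changes [sigma x] only modulo itself. Both
    the congruence given by the orbits of an ideal and the uniqueness of the
    minimal ideal come from this. *)
Lemma ideal_sigma_coset I g x : brace_ideal I -> g \in I ->
  brace_sigma x * (brace_sigma (perm_of_brace g x))^-1 \in I.
Proof.
move=> idI gI; have := ideal_lambda_coset (brace_sigma x)^-1 idI gI.
by rewrite invgK lambda_brace_sigma.
Qed.

Lemma acts_transitivelyP I :
  acts_transitively I <->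
  forall x y, exists2 g, g \in I & perm_of_brace g x = y.
Proof.
split=> [/imsetP[z _ zT] x y|trI].
  have orbz u : exists2 g, g \in I & perm_of_brace g z = u.
    have: u \in [set: X] by [].
    by rewrite zT => /imsetP[_ /imsetP[g gI ->] ->]; exists g.
  have [g gI <-] := orbz x; have [h hI <-] := orbz y.
  exists (h * g^-1); first by rewrite groupM ?groupV.
  by rewrite perm_of_braceM perm_of_braceV permK.
have /card_gt0P[z _] := @cycle_set_nonempty X.
apply/imsetP; exists z => //; apply/esym/setP => y; rewrite inE.
have [g gI <-] := trI z y.
by apply/imsetP; exists (perm_of_brace g) => //; apply: imset_f.
Qed.

Lemma acts_transitivelyS I J :
  I \subset J -> acts_transitively I -> acts_transitively J.
Proof.
move=> /subsetP sIJ /acts_transitivelyP trI; apply/acts_transitivelyP => x y.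
by have [g /sIJ gJ <-] := trI x y; exists g.
Qed.

Lemma indecomposableE :
  indecomposable X <-> acts_transitively [set: perm_brace X]%G.
Proof.
suff GE : perm_group X = @perm_of_brace X @: [set: perm_brace X] :> {set _}.
  by rewrite /acts_transitively -GE.
apply/setP => s; apply/idP/imsetP => [sG|[g _ ->]]; last exact: subgP.
by exists (Subg sG).
Qed.

Lemma transitive_brace_nontrivial :
  1 < #|{: X}| -> indecomposable X -> nontrivial_ideal [set: perm_brace X]%G.
Proof.
move=> X1 /indecomposableE/acts_transitivelyP trX.
split; first exact: brace_idealT.
move=> /= GE; have /card_gt1P[x [y [_ _ /eqP]]] := X1; apply.
have [g _ <-] := trX x y.
have: g \in [set: perm_brace X] by rewrite inE.
by rewrite GE brace_zero_one => /set1P ->; rewrite /perm_of_brace perm1.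
Qed.

(** If [I] and [J] are both transitive, then any two [sigma x] agree modulo
    [I] and modulo [J], hence modulo [I :&: J]; so irretractability forbids
    two transitive ideals from meeting trivially. *)
Lemma transitive_ideals_meet I J :
    1 < #|{: X}| -> irretractable X ->
    brace_ideal I -> brace_ideal J ->
    acts_transitively I -> acts_transitively J ->
  nontrivial_ideal (I :&: J)%G.
Proof.
move=> X1 irr idI idJ /acts_transitivelyP trI /acts_transitivelyP trJ.
split; first exact: brace_idealI.
move=> /= IJ0; have /card_gt1P[x [y [_ _ /eqP]]] := X1; apply; apply: irr.
have: brace_sigma x * (brace_sigma y)^-1 \in I :&: J.
  have [g gI gx] := trI x y; have [h hJ hx] := trJ x y.
  rewrite inE -{1}gx (ideal_sigma_coset x idI gI) -hx.
  exact: (ideal_sigma_coset x idJ hJ).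
rewrite IJ0 brace_zero_one => /set1P/(canRL (mulgKV _)).
by rewrite mul1g => /(congr1 (@perm_of_brace X)).
Qed.

End Action.

(** * Quotients by congruences *)

Lemma cancel_fin_bij (T : finType) (f g : T -> T) : cancel g f -> bijective f.
Proof. move=> gK; exact: bij_can_bij (injF_bij (can_inj gK)) _ gK. Qed.

Lemma surj_card_bij (T U : finType) (f : T -> U) :
  (forall y, exists x, f x = y) -> #|U| = #|T| -> bijective f.
Proof.
move=> surjf UT.
have/eqP/imset_injP injf: #|f @: T| = #|T|.
  rewrite -UT -cardsT; apply/eq_card => y; rewrite inE.
  by have [x <-] := surjf y; apply: imset_f.
by apply: inj_card_bij; rewrite ?UT // => x y; apply: injf.
Qed.

Definition cycle_congruence (X : cycleSetType) (e : rel X) : Prop :=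
  equivalence_rel e /\
  forall x x' y y', e x x' -> e y y' -> e (x · y) (x' · y').

Section Quotient.
Variables (X : cycleSetType) (e : rel X).
Hypothesis congr_e : cycle_congruence e.

Let e_refl x : e x x. Proof. by have [E _] := congr_e; have [] := E x x x. Qed.
Let e_left : left_transitive e.
Proof. by have [/equivalence_relP[_]] := congr_e. Qed.
Let e_sym x y : e x y = e y x.
Proof. by apply/idP/idP => /e_left <-. Qed.

Let rep x := choose (e x) x.
Let e_rep x : e x (rep x). Proof. exact: chooseP (e_refl x). Qed.
Let eq_rep x y : e x y -> rep x = rep y.
Proof.
move=> exy; rewrite /rep -(eq_choose (e_left exy)).
exact: choose_id (e_refl x) exy.
Qed.

Local Notation Q := {x : X | rep x == x}.
Let rep_idem x : rep (rep x) == rep x. Proof. by rewrite -(eq_rep (e_rep x)). Qed.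
Let cls x : Q := exist _ (rep x) (rep_idem x).
Let cls_sval (u : Q) : cls (sval u) = u.
Proof. by apply: val_inj => /=; apply/eqP; apply: (valP u). Qed.
Let cls_eq x y : cls x = cls y <-> e x y.
Proof.
split=> [/(congr1 val) /= rxy|exy]; last by apply: val_inj => /=; apply: eq_rep.
by rewrite (e_left (e_rep x)) rxy e_sym.
Qed.
Let dotQ (u v : Q) := cls (sval u · sval v).
Let cls_dot x y : cls (x · y) = dotQ (cls x) (cls y).
Proof. by apply/cls_eq; apply: (proj2 congr_e). Qed.

(** The left multiplications and the squaring map of the quotient are induced
    by surjections, so they are surjective, hence bijective by finiteness: any
    congruence gives a cycle set that is non-degenerate again. *)
Lemma congruence_quotient :
  exists (Y : cycleSetType) (f : X -> Y),
    cycle_epi f /\ forall x y, f x = f y <-> e x y.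
Proof.
have dot_bij (u : Q) : bijective (dotQ u).
  have [s' _ s'K] := cdot_bij (sval u).
  apply: (@cancel_fin_bij _ _ (fun w => cls (s' (sval w)))) => w.
  by rewrite -{1}(cls_sval u) -cls_dot s'K cls_sval.
have dot_cycle (u v w : Q) :
    dotQ (dotQ u v) (dotQ u w) = dotQ (dotQ v u) (dotQ v w).
  by rewrite -!cls_dot cdot_cycle.
have dot_nd : bijective (fun u => dotQ u u).
  have [s' _ s'K] := @cdot_nondegenerate X.
  apply: (@cancel_fin_bij _ _ (fun w => cls (s' (sval w)))) => w.
  by rewrite -cls_dot s'K cls_sval.
have Q0 : 0 < #|{: Q}|.
  have /card_gt0P[x _] := @cycle_set_nonempty X.
  by apply/card_gt0P; exists (cls x).
pose Y : cycleSetType :=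
  HB.pack Q (isCycleSet.Build Q dot_bij dot_cycle dot_nd Q0).
exists Y, cls; split; last exact: cls_eq.
by split=> [x y|u]; [exact: cls_dot | exists (sval u); apply: cls_sval].
Qed.

Lemma simple_congruence :
  simple_cycle_set X -> (forall x y, e x y) \/ (forall x y, e x y -> x = y).
Proof.
case=> _ simX; have [Y [f [epif fE]]] := congruence_quotient.
have [Y1|[_ bijf]] := simX Y f epif; [left|right] => x y.
  by apply/fE; apply: (fintype_le1P _); rewrite Y1.
by move/fE/(bij_inj bijf).
Qed.

End Quotient.

(** * Epimorphisms *)

Section Epimorphism.
Variables (X Y : cycleSetType) (f : X -> Y).
Hypothesis epi_f : cycle_epi f.
Implicit Types (g h : perm_brace X) (k l : perm_brace Y).

Lemma epi_card : #|{: Y}| <= #|{: X}|.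
Proof.
rewrite -[#|Y|]cardsT; suff <- : f @: X = [set: Y] by apply: leq_imset_card.
by apply/setP => y; rewrite inE; have [x <-] := proj2 epi_f y; apply: imset_f.
Qed.

Lemma epi_inj_iso : injective f -> cycle_iso f.
Proof.
by move=> injf; split; [case: epi_f | apply: inj_card_bij epi_card].
Qed.

Lemma epi_card_iso : #|{: Y}| = #|{: X}| -> cycle_iso f.
Proof. by case: epi_f => homf surjf XY; split=> //; apply: surj_card_bij. Qed.

Definition induces g k : Prop :=
  forall x, f (perm_of_brace g x) = perm_of_brace k (f x).

Lemma induces_sigma x : induces (brace_sigma x) (brace_sigma (f x)).
Proof. by move=> z; rewrite !perm_of_brace_sigma (proj1 epi_f). Qed.

Lemma induces_uniq g k l : induces g k -> induces g l -> k = l.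
Proof.
move=> gk gl; apply: perm_of_brace_inj; apply/permP => y.
by have [x <-] := proj2 epi_f y; rewrite -gk gl.
Qed.

Lemma induces1 : induces 1 1.
Proof. by move=> x; rewrite /perm_of_brace !perm1. Qed.

Lemma inducesM g h k l : induces g k -> induces h l -> induces (g * h) (k * l).
Proof. by move=> gk hl x; rewrite !perm_of_braceM gk hl. Qed.

Lemma inducesV g k : induces g k -> induces g^-1 k^-1.
Proof.
by move=> gk x; rewrite !perm_of_braceV; apply: (canRL (permK _)); rewrite -gk permKV.
Qed.

(** The relation [induces] is the graph of a homomorphism of braces. Since
    addition is known only through [g + (sigma y)^-1], additivity is proved by
    induction on the second summand, along with the existence of an image. *)
Lemma inducesD h :
  exists2 l, induces h l &
    forall g k, induces g k -> induces (g + h)%R (k + l)%R.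
Proof.
elim/brace_gen_ind: h => [|h x [l hl IH]].
  exists 1 => [|g k gk]; first exact: induces1.
  by rewrite -!brace_zero_one !addr0.
have tr g k y : induces g k ->
    induces (g + (brace_sigma y)^-1%g)%R (k + (brace_sigma (f y))^-1%g)%R.
  move=> gk; rewrite !perm_brace_addE; apply/inducesM/inducesV => //.
  by rewrite -!perm_of_braceV -(inducesV gk); apply: induces_sigma.
set y := perm_of_brace h x.
have -> : h * (brace_sigma x)^-1 = (h + (brace_sigma y)^-1%g)%R.
  by rewrite perm_brace_addE permK.
exists (l + (brace_sigma (f y))^-1%g)%R => [|g k gk]; first exact: tr.
by rewrite !addrA; apply/tr/IH.
Qed.

Definition epi_kernel_set : {set perm_brace X} :=
  [set g | [forall x, f (perm_of_brace g x) == f x]].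

Lemma epi_kernelP g : reflect (induces g 1) (g \in epi_kernel_set).
Proof.
by rewrite inE; apply: (iffP forallP) => gk x; have := gk x;
  rewrite [perm_of_brace 1 _]perm1 => /eqP.
Qed.

Lemma epi_kernel_group_set : group_set epi_kernel_set.
Proof.
apply/group_setP; split=> [|g h /epi_kernelP gK /epi_kernelP hK].
  by apply/epi_kernelP; apply: induces1.
by apply/epi_kernelP; rewrite -[1]mulg1; apply: inducesM.
Qed.

Canonical epi_kernel := Group epi_kernel_group_set.

Lemma epi_kernel_ideal : brace_ideal epi_kernel.
Proof.
split=> [|g h /epi_kernelP hK].
  apply/andP; split; first exact: subsetT.
  apply/normsP => g _; apply/setP => h; have [k gk _] := inducesD g.
  rewrite mem_conjg; apply/epi_kernelP/epi_kernelP => hK.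
    rewrite -[h](conjgKV g) -(conj1g k) !conjgE.
    by do !apply: inducesM => //; apply: inducesV.
  rewrite -(conj1g k^-1) !conjgE.
  by do !apply: inducesM => //; do !apply: inducesV.
(* Compare the images of [g + brace_lambda g h = g * h] on both sides. *)
have [k gk _] := inducesD g; have [l ll addl] := inducesD (brace_lambda g h).
have := addl g k gk; rewrite -brace_mul_lambda => /induces_uniq/(_ (inducesM gk hK)).
rewrite mulg1 => /(canRL (addKr _)); rewrite addNr brace_zero_one => l1.
by apply/epi_kernelP; rewrite -l1.
Qed.

(** Elements with the same image have left multiplications that agree modulo
    the kernel. *)
Lemma epi_kernel_trivial_inj :
  irretractable X -> epi_kernel_set = [set 0%R] -> injective f.
Proof.
move=> irr K0 x y fxy; apply: irr.
have: brace_sigma x * (brace_sigma y)^-1 \in epi_kernel_set.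
  apply/epi_kernelP; rewrite -(mulgV (brace_sigma (f x))) {2}fxy.
  by apply/inducesM/inducesV; apply: induces_sigma.
rewrite K0 brace_zero_one => /set1P/(canRL (mulgKV _)).
by rewrite mul1g => /(congr1 (@perm_of_brace X)).
Qed.

Lemma epi_kernel_transitive : acts_transitively epi_kernel -> #|{: Y}| = 1%N.
Proof.
move/acts_transitivelyP=> trK; apply/eqP; rewrite eqn_leq cycle_set_nonempty andbT.
apply/fintype_le1P => u v.
have [x <-] := proj2 epi_f u; have [y <-] := proj2 epi_f v.
by have [g /epi_kernelP gK <-] := trK x y; rewrite gK [perm_of_brace 1 _]perm1.
Qed.

(** A transitive group permutes the fibres of [f] transitively, so they all
    have the same size. *)
Lemma indecomposable_epi_dvd : indecomposable X -> #|{: Y}| %| #|{: X}|.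
Proof.
move/indecomposableE/acts_transitivelyP=> trX.
pose F y := [pred x | f x == y].
have leF u v : #|F u| <= #|F v|.
  have [x <-] := proj2 epi_f u; have [y <-] := proj2 epi_f v.
  have [g _ gx] := trX x y; have [k gk _] := inducesD g.
  rewrite -(card_image (@perm_inj _ (perm_of_brace g))); apply/subset_leq_card.
  apply/subsetP => _ /imageP[z /eqP fz ->].
  by rewrite inE gk fz -gk gx.
have /card_gt0P[y0 _] := @cycle_set_nonempty Y.
have -> : #|{: X}| = (\sum_(y : Y) #|F y|)%N.
  rewrite -sum1_card (partition_big f xpredT) //=.
  by apply: eq_bigr => y _; rewrite -sum1_card.
rewrite (eq_bigr (fun=> #|F y0|)) => [|y _]; last first.
  by apply/eqP; rewrite eqn_leq !leF.
by rewrite sum_nat_const dvdn_mulr.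
Qed.

End Epimorphism.

Lemma prime_indecomposable_simple (X : cycleSetType) :
  prime #|{: X}| -> indecomposable X -> simple_cycle_set X.
Proof.
move=> prX indX; split=> [|Y f epif]; first exact: prime_gt1.
have := indecomposable_epi_dvd epif indX.
move/(primeP prX).2 => /orP[/eqP|/eqP YX]; [by left | right].
exact: epi_card_iso.
Qed.

Lemma simple_card2 (X : cycleSetType) : #|{: X}| = 2%N -> simple_cycle_set X.
Proof.
move=> X2; split=> [|Y f epif]; first by rewrite X2.
have := epi_card epif; rewrite X2 leq_eqVlt ltnS => /orP[/eqP YX|Y1].
  by right; apply: epi_card_iso; rewrite // X2.
by left; apply/eqP; rewrite eqn_leq Y1 cycle_set_nonempty.
Qed.

Lemma simple_isomorphic (X Z : cycleSetType) :
  cycle_isomorphic X Z -> simple_cycle_set Z -> simple_cycle_set X.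
Proof.
case=> f [homf bijf] [Z1 simZ]; split=> [|Y g [homg surjg]].
  by rewrite (bij_eq_card bijf).
have [f' fK f'K] := bijf.
have epi_gf : cycle_epi (g \o f').
  split=> [z w|y] /=.
    by rewrite -homg; congr g; apply: (bij_inj bijf); rewrite homf !f'K.
  by have [x <-] := surjg y; exists (f x); rewrite /= fK.
have [Y1|[_ bijgf]] := simZ Y (g \o f') epi_gf; first by left.
right; split=> //; apply: (eq_bij (bij_comp bijgf bijf)) => x /=.
by rewrite fK.
Qed.

(** * Simple cycle sets *)

Section Simple.
Variable X : cycleSetType.
Implicit Types (x y z : X) (g h : perm_brace X) (I : {group (perm_brace X)}).

Lemma ideal_orbit_congruence I : brace_ideal I ->
  cycle_congruence (fun x y => [exists g in I, perm_of_brace g x == y]).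
Proof.
move=> idI.
have orbP x y : reflect (exists2 g, g \in I & perm_of_brace g x = y)
                        [exists g in I, perm_of_brace g x == y].
  by apply: (iffP exists_inP) => -[g gI /eqP]; exists g.
split.
  apply/equivalence_relP; split=> [x|x y /orbP[g gI <-] z].
    by apply/orbP; exists 1; rewrite // /perm_of_brace perm1.
  apply/orbP/orbP => -[h hI <-].
    exists (h * g^-1); first by rewrite groupM ?groupV.
    by rewrite perm_of_braceM perm_of_braceV permK.
  by exists (h * g); rewrite ?groupM ?perm_of_braceM.
move=> x _ y _ /orbP[g gI <-] /orbP[h hI <-]; apply/orbP.
(* [c] takes [x · y] to [x · h y], and [k] takes that to [g x · h y]. *)
set k := (brace_sigma x * (brace_sigma (perm_of_brace g x))^-1)^-1.
pose c := h ^ (brace_sigma x)^-1.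
have nI b : b \in 'N(I) by case: idI => /andP[_ /subsetP nI] _; rewrite nI ?inE.
exists (k * c).
  by rewrite groupM ?memJ_norm // groupV ideal_sigma_coset.
rewrite -!perm_of_brace_sigma -!perm_of_braceM; congr (perm_of_brace _ y).
by rewrite /k /c conjgE !invgK invMg invgK -!mulgA mulVg mulg1 mulKg.
Qed.

Lemma retract_congruence : cycle_congruence (fun x y => sigma x == sigma y).
Proof.
split=> [x y z|x x' y y' /eqP xx' /eqP yy'].
  by split=> // /eqP ->.
have dot_eq (u v w : X) : sigma u = sigma v -> u · w = v · w.
  by move=> uv; have /permP/(_ w) := uv; rewrite !permE.
(* The cycle identity turns the left factor [sigma (x · y)], which depends on
   [y], into terms where [y] only acts through [sigma y]. *)
apply/eqP/permP => t; rewrite !permE.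
have [s' _ s'K] := cdot_bij x; rewrite -(s'K t) (dot_eq _ _ y' (esym xx')).
by rewrite !(cdot_cycle x) !(dot_eq _ _ _ yy').
Qed.

(** Orbits of an ideal form a congruence, whose quotient is either a point or
    [X] itself; in the latter case the ideal fixes every point, so it is
    trivial, its elements being permutations of [X]. *)
Lemma simple_ideal_transitive I :
  simple_cycle_set X -> nontrivial_ideal I -> acts_transitively I.
Proof.
move=> simX [idI ntI].
have [allI|trivI] := simple_congruence (ideal_orbit_congruence idI) simX.
  by apply/acts_transitivelyP => x y; have /exists_inP[g gI /eqP] := allI x y; exists g.
case: ntI; apply/eqP; rewrite brace_zero_one eqEsubset sub1G andbT.
apply/subsetP => g gI; rewrite inE; apply/eqP/perm_of_brace_inj/permP => x.
by rewrite [RHS]perm1; apply/esym/trivI/exists_inP; exists g.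
Qed.

(** If [perm_brace X] were trivial, then any partition would be a congruence,
    and a partition of a set of more than two points into two parts
    contradicts simplicity. *)
Lemma simple_indecomposable :
  2 < #|{: X}| -> simple_cycle_set X -> indecomposable X.
Proof.
move=> X2 simX; apply/indecomposableE/simple_ideal_transitive => //.
split=> [|/= G0]; first exact: brace_idealT.
have dotE x y : x · y = y.
  have: brace_sigma x \in [set: perm_brace X] by rewrite inE.
  rewrite -perm_of_brace_sigma G0 brace_zero_one => /set1P ->.
  exact: perm1.
have /card_gt2P[x [y [z [_ [xy yz zx]]]]] := X2.
have congr : cycle_congruence (fun u v => (u == x) == (v == x)).
  split=> [u v w|u u' v v' _]; last by rewrite !dotE.
  by split=> // /eqP ->.
have [all|inj] := simple_congruence congr simX.
  by have := all x y; rewrite eqxx [y == x]eq_sym (negPf xy).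
suff /eqP : y = z by rewrite (negPf yz).
by apply: inj; rewrite [y == x]eq_sym (negPf xy) (negPf zx).
Qed.

Section CommonSigma.
Variable s : {perm X}.
Hypothesis sigma_s : forall x, sigma x = s.
Hypothesis indX : indecomposable X.

Let dot_s x y : x · y = s y. Proof. by rewrite -(sigma_s x) permE. Qed.

Let s_orbit x y : exists n, (s ^+ n) x = y.
Proof.
have /indecomposableE/acts_transitivelyP/(_ x y)[[g gG] _ /= <-] := indX.
have : g \in <[s]>.
  apply: subsetP gG; rewrite gen_subG.
  by apply/subsetP => _ /imsetP[z _ ->]; rewrite sigma_s cycle_id.
by case/cycleP=> n ->; exists n.
Qed.

Let s_porbit x : porbit s x = [set: X].
Proof.
by apply/setP => y; rewrite inE; have [n <-] := s_orbit x y; apply: mem_porbit.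
Qed.

Let s_card : s ^+ #|{: X}| = 1.
Proof.
by apply/permP => x; rewrite permX perm1 -cardsT -(s_porbit x) iter_porbit.
Qed.

Let card_dvd_order (t : {perm X}) x : porbit t x = [set: X] -> #|{: X}| %| #[t].
Proof. by rewrite -cardsT porbitE => <-; apply: dvdn_orbit. Qed.

(** The orbits of a power of [s] form a congruence. Take the power whose
    exponent is the least prime divisor [p] of [#|X|]: its order divides
    [#|X| / p], so it is not transitive; hence it is the identity by simplicity,
    and [#|X|], being the length of the cycle [s], divides [p]. *)
Lemma simple_common_sigma_prime :
  1 < #|{: X}| -> simple_cycle_set X -> prime #|{: X}|.
Proof.
set n := #|{: X}| => n1 simX; pose p := pdiv n; pose t := s ^+ p.
have pr_p : prime p by apply: pdiv_prime.
have /card_gt0P[x0 _] := @cycle_set_nonempty X.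
have congr : cycle_congruence (fun x y => porbit t x == porbit t y).
  split=> [x y z|x x' y y' _]; first by split=> // /eqP ->.
  rewrite !dot_s eq_porbit_mem => /porbitP[i ->]; rewrite eq_porbit_mem.
  have -> : s ((t ^+ i) y') = (t ^+ i) (s y').
    by rewrite -!permM /t -expgM -expgS -expgSr.
  exact: mem_porbit.
have [all|inj] := simple_congruence congr simX.
  have tT : porbit t x0 = [set: X].
    by apply/setP => y; rewrite inE -eq_porbit_mem all.
  have p_n : p %| n := pdiv_dvd n.
  have q0 : 0 < n %/ p by rewrite divn_gt0 ?prime_gt0 // dvdn_leq // ltnW.
  have t_q : #[t] %| n %/ p.
    by rewrite order_dvdn /t -expgM mulnC divnK // s_card.
  have := dvdn_leq q0 (dvdn_trans (card_dvd_order tT) t_q).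
  by rewrite leqNgt ltn_Pdiv ?prime_gt1 // ltnW.
have t1 : t = 1.
  apply/permP => x; rewrite perm1; apply: inj.
  by rewrite eq_porbit_mem (mem_porbit t 1).
have : n %| p.
  by apply: dvdn_trans (card_dvd_order (s_porbit x0)) _; rewrite order_dvdn; apply/eqP.
move/(primeP pr_p).2 => /orP[/eqP n1'|/eqP -> //].
by rewrite n1' in n1.
Qed.

(** The isomorphism is the inverse of [k |-> s^k x0] for a base point [x0]. *)
Lemma common_sigma_cyclic :
  prime #|{: X}| -> cycle_isomorphic X (cyclic_cycle_set #|{: X}|).
Proof.
set p := #|{: X}| => pr_p.
have /card_gt0P[x0 _] := @cycle_set_nonempty X.
pose f (k : cyclic_cycle_set p) : X := (s ^+ (k : 'Z_p)) x0.
have s_mod j : s ^+ (j %% (Zp_trunc p).+2) = s ^+ j.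
  by rewrite Zp_cast ?prime_gt1 // expg_mod.
have surjf y : exists k, f k = y.
  have [n <-] := s_orbit x0 y.
  by exists (inZp n : 'Z_p); rewrite /f /= s_mod.
have bijf : bijective f.
  by apply: surj_card_bij => //; rewrite cyclic_cycle_set_card.
have [f' fK f'K] := bijf; exists f'; split; last by exists f.
move=> x y; apply: (bij_inj bijf); rewrite f'K dot_s.
have -> : s y = s (f (f' y)) by rewrite f'K.
by rewrite /f -permM -expgSr /= modnDmr addn1 s_mod.
Qed.

End CommonSigma.

(** The retraction, quotient by equality of the [sigma x], is either [X] itself
    or a point; in the latter case all [sigma x] are the same permutation. *)
Lemma simple_irretractable_or_cyclic :
    1 < #|{: X}| -> indecomposable X -> simple_cycle_set X ->
  irretractable X \/
  exists2 p : nat, prime p & cycle_isomorphic X (cyclic_cycle_set p).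
Proof.
move=> X1 indX simX.
have [all|inj] := simple_congruence retract_congruence simX; last first.
  by left=> x y /eqP; apply: inj.
right; have /card_gt0P[x0 _] := @cycle_set_nonempty X.
have sig x : sigma x = sigma x0 by apply/eqP/all.
have prX := simple_common_sigma_prime sig indX X1 simX.
by exists #|{: X}|; last exact: common_sigma_cyclic sig indX prX.
Qed.

Lemma ideals_transitive_simple :
    1 < #|{: X}| -> irretractable X ->
    (forall I, nontrivial_ideal I -> acts_transitively I) ->
  simple_cycle_set X.
Proof.
move=> X1 irr trI; split=> // Y f epif.
have [K0|/eqP K1] := eqVneq (epi_kernel_set f) [set 0%R].
  by right; apply: epi_inj_iso => //; apply: epi_kernel_trivial_inj K0.
left; apply: epi_kernel_transitive (epif) _; apply: trI.
by split=> //; apply: epi_kernel_ideal.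
Qed.

End Simple.

Theorem corollary14 (X : cycleSetType) :
  (#|{: X}| = 2%N -> simple_cycle_set X) /\
  ((2 < #|{: X}|)%N ->
    let prime_case :=
      exists2 p : nat, prime p & cycle_isomorphic X (cyclic_cycle_set p) in
    let cond1 := simple_cycle_set X in
    let cond2 :=
      prime_case \/
      [/\ irretractable X, indecomposable X &
          forall I : {group (perm_brace X)},
            nontrivial_ideal I -> acts_transitively I] in
    let cond3 :=
      prime_case \/
      [/\ irretractable X, indecomposable X &
          exists2 I : {group (perm_brace X)},
            minimal_ideal I /\
            (forall J : {group (perm_brace X)}, minimal_ideal J -> J = I) &
            acts_transitively I] in
    (cond1 <-> cond2) /\ (cond2 <-> cond3)).
Proof.
split=> [|X2 prime_case cond1 cond2 cond3]; first exact: simple_card2.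
have X1 : 1 < #|{: X}| := ltnW X2.
split; split.
- move=> simX; have indX := simple_indecomposable X2 simX.
  have [irr|] := simple_irretractable_or_cyclic X1 indX simX; last by left.
  by right; split=> // I; apply: simple_ideal_transitive.
- case=> [[p pr_p isoX]|[irr _ trI]]; last exact: ideals_transitive_simple.
  apply: (simple_isomorphic isoX); apply: prime_indecomposable_simple.
    by rewrite cyclic_cycle_set_card.
  exact: cyclic_cycle_set_indecomposable.
- case=> [|[irr indX trI]]; [by left | right; split=> //].
  have [I mI _] := minimal_ideal_exists (transitive_brace_nontrivial X1 indX).
  have [ntI _] := mI; exists I; last exact: trI.
  split=> // J [ntJ minJ].
  have ntIJ := transitive_ideals_meet X1 irr ntI.1 ntJ.1 (trI _ ntI) (trI _ ntJ).
  by rewrite -(minJ _ ntIJ (subsetIr I J)) (mI.2 _ ntIJ (subsetIl I J)).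
- case=> [|[irr indX [I [mI uniqI] trI]]]; [by left | right; split=> // J ntJ].
  have [K /uniqI -> sIJ] := minimal_ideal_exists ntJ.
  exact: acts_transitivelyS sIJ trI.
Qed.
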